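(* For every integer $n\ge 1$, $$\mathrm{LB}_n(112)=\mathrm{RS}_n(112)=\mathrm{LB}_n(122)=\sum_{t\ge 0}\begin{bmatrix} n-1\\ t\end{bmatrix}_q .$$
   Context: A restricted growth function (RGF) of length $n$ is a sequence $w=w_1\dots w_n$ of positive integers with $w_1=1$ and $w_i\le 1+\max\{w_1,\dots,w_{i-1}\}$ for $i\ge 2$ ($R_0$ consists of the empty word); $R_n$ is the set of RGFs of length $n$. The standardization of a word replaces every occurrence of its smallest letter by $1$, of its next smallest letter by $2$, and so on. An RGF $w$ contains an RGF $v$ if some subword (subsequence, not necessarily consecutive) of $w$ standardizes to $v$; otherwise $w$ avoids $v$. $R_n(v)$ is the set of $w\in R_n$ avoiding $v$. For a word $w$ and position $j$: $\mathrm{lb}(w_j)$ is the number of distinct values $w_i$ with $i<j$ and $w_i>w_j$; $\mathrm{rs}(w_j)$ is the number of distinct values $w_i$ with $i>j$ and $w_i<w_j$; $\mathrm{lb}(w)=\sum_j \mathrm{lb}(w_j)$, $\mathrm{rs}(w)=\sum_j\mathrm{rs}(w_j)$. Then $\mathrm{LB}_n(v)=\sum_{w\in R_n(v)}q^{\mathrm{lb}(w)}$ and $\mathrm{RS}_n(v)=\sum_{w\in R_n(v)}q^{\mathrm{rs}(w)}$. Here $[m]_q=1+q+\dots+q^{m-1}$, $[m]_q!=[1]_q\cdots[m]_q$, $\begin{bmatrix} n\\ k\end{bmatrix}_q=\frac{[n]_q!}{[k]_q![n-k]_q!}$ for $0\le k\le n$, and it is $0$ if $k<0$ or $k>n$.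 *)

(* Defs.v *)
From HB Require Import structures.
From mathcomp Require Import all_boot all_order all_algebra.
From mathcomp Require Import boolp classical_sets functions cardinality fsbigop.

Set Implicit Arguments.
Unset Strict Implicit.
Unset Printing Implicit Defensive.

Import Order.TTheory GRing.Theory Num.Theory.

Local Open Scope nat_scope.

(* The i-th letter of w, for 1 <= i <= size w, is [nth 0 w i.-1]. *)
Definition is_rgf (w : seq nat) : Prop :=
  [/\ all (fun x => 0 < x) w,
      0 < size w -> nth 0 w 0 = 1
    & forall i, 0 < i < size w ->
        nth 0 w i <= 1 + \max_(x <- take i w) x].

Definition standardize (w : seq nat) : seq nat :=
  [seq (index x (sort leq (undup w))).+1 | x <- w].

Definition contains (w v : seq nat) : Prop :=
  exists2 u : seq nat, subseq u w & standardize u = v.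

Definition avoids (w v : seq nat) : Prop := ~ contains w v.

Local Open Scope classical_set_scope.

Definition RGF (n : nat) : set (seq nat) :=
  [set w | size w = n /\ is_rgf w].

Definition RGF_av (n : nat) (v : seq nat) : set (seq nat) :=
  [set w | RGF n w /\ avoids w v].

Local Close Scope classical_set_scope.

Definition lb_at (w : seq nat) (j : nat) : nat :=
  size (undup [seq x <- take j w | nth 0 w j < x]).

Definition rs_at (w : seq nat) (j : nat) : nat :=
  size (undup [seq x <- drop j.+1 w | x < nth 0 w j]).

Definition lb (w : seq nat) : nat := \sum_(j < size w) lb_at w j.

Definition rs (w : seq nat) : nat := \sum_(j < size w) rs_at w j.

Local Open Scope ring_scope.

(* The indeterminate q is 'X. The sums are sums over a set of words, which
   would be 0 by convention if infinitely many words were involved; this does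
   not happen, by [finite_RGF_av] below. *)
Definition LB (n : nat) (v : seq nat) : {poly int} :=
  \sum_(w \in RGF_av n v) ('X^(lb w) : {poly int}).

Definition RS (n : nat) (v : seq nat) : {poly int} :=
  \sum_(w \in RGF_av n v) ('X^(rs w) : {poly int}).

Definition qint (m : nat) : {poly int} := \sum_(i < m) 'X^i.

Definition qfact (m : nat) : {poly int} := \prod_(1 <= i < m.+1) qint i.

(* [%/] is Euclidean division by a monic polynomial; it is exact here, by
   [qbinomM] below. *)
Definition qbinom (n k : nat) : {poly int} :=
  if (k <= n)%N then qfact n %/ (qfact k * qfact (n - k)) else 0.

Lemma finite_RGF n : finite_set (RGF n).
Proof.
apply: (@sub_finite_set _ _
  ((fun t : n.-tuple 'I_n.+1 => map val t) @` setT)%classic); last first.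
  exact/finite_image/finite_finset.
move=> w [sz [_ w1 wS]].
have wle i : (i < size w)%N -> (nth 0 w i <= i.+1)%N.
  elim/ltn_ind: i => -[|i] IH ltiw; first by rewrite w1.
  apply: leq_trans (wS i.+1 _) _ => //.
  rewrite add1n ltnS; apply/bigmax_leqP_seq => x /(nthP 0)[j].
  rewrite size_take ltiw => ltj <- _; rewrite nth_take //.
  by apply: leq_trans (IH _ ltj _) _ => //; apply: ltn_trans ltiw.
have szt : size (map (@inord n) w) == n by rewrite size_map sz.
exists (Tuple szt) => //=.
rewrite -map_comp -[RHS]map_id; apply/eq_in_map => x /(nthP 0)[j ltj <-] /=.
rewrite inordK // ltnS; apply: leq_trans (wle _ ltj) _.
by rewrite -sz.
Qed.

Lemma finite_RGF_av n v : finite_set (RGF_av n v).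
Proof. by apply: sub_finite_set (finite_RGF n) => w []. Qed.

Lemma qintE m : qint m = \poly_(i < m) 1.
Proof. by rewrite poly_def; apply: eq_bigr => i _; rewrite scale1r. Qed.

Lemma qint_monic m : (0 < m)%N -> qint m \is monic.
Proof.
case: m => // m _; rewrite monicE lead_coefE qintE.
by rewrite size_poly_eq ?oner_eq0 //= coef_poly ltnSn.
Qed.

Lemma qfact_monic m : qfact m \is monic.
Proof.
rewrite /qfact big_nat; apply: rpred_prod => i /andP[i0 _].
exact: qint_monic.
Qed.

Lemma qfactS m : qfact m.+1 = qfact m * qint m.+1.
Proof. by rewrite /qfact big_nat_recr. Qed.

Lemma qintD m k : qint (m + k) = qint m + 'X^m * qint k.
Proof.
rewrite /qint big_split_ord /= mulr_sumr; congr (_ + _).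
by apply: eq_bigr => i _; rewrite exprD.
Qed.

Lemma qfact_dvd a b : exists p, qfact (a + b) = p * (qfact a * qfact b).
Proof.
have [n] := ubnP (a + b); elim: n a b => // n IH [|a] [|b]; rewrite ?addn0 => ltn.
- by exists 1; rewrite /qfact !big_geq // !mulr1.
- by exists 1; rewrite /qfact [in X in _ = _ * (X * _)]big_geq // !mul1r.
- by exists 1; rewrite /qfact [in X in _ = _ * (_ * X)]big_geq // mulr1 mul1r.
have [p Ep] : exists p, qfact (a + b.+1) = p * (qfact a * qfact b.+1).
  by apply: IH; rewrite -ltnS -addSn.
have [r Er] : exists r, qfact (a.+1 + b) = r * (qfact a.+1 * qfact b).
  by apply: IH; rewrite -ltnS -addnS.
exists (p + 'X^(a.+1) * r).
rewrite addSn qfactS -addSn qintD mulrDr {1}Ep addnS -addSn Er mulrDl.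
congr (_ + _); first by rewrite -mulrA [qfact a.+1]qfactS [in LHS]mulrAC.
by rewrite mulrACA [qfact b.+1]qfactS ['X^_ * r]mulrC [qfact a.+1 * (_ * _)]mulrA.
Qed.

Lemma qbinomM n k : (k <= n)%N ->
  qbinom n k * (qfact k * qfact (n - k)) = qfact n.
Proof.
move=> lekn; rewrite /qbinom lekn.
have [p] := qfact_dvd k (n - k); rewrite subnKC // => ->.
by rewrite Pdiv.IdomainMonic.mulpK // rpredM ?qfact_monic.
Qed.

(* Main.v *)
(** In a word of [RGF_av n.+1 v], for v = 112 or 122, either the last letter
    is a removable 1, or the word arises from a shorter one by a step adding 1
    to the maximum: prepend 1 and increase all letters (112), or append a new
    maximum (122). So these words are coded by bit sequences of length n, the
    number of [true] bits being the maximum minus 1. Under this code lb is the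
    inversion statistic for both patterns, and rs on 112-avoiders is the major
    index; by MacMahon's equidistribution, proved here from the two q-Pascal
    rules, both have generating function [qbinom n t] over the sequences with
    t [true] bits. *)

Require Import Defs.
From mathcomp Require Import all_boot all_order all_algebra.
From mathcomp Require Import boolp classical_sets functions cardinality fsbigop.
From mathcomp Require Import ring.

Set Implicit Arguments.
Unset Strict Implicit.
Unset Printing Implicit Defensive.

Import GRing.Theory.


(** * Restricted growth functions: maximum, appending and shifting *)

Lemma max_rcons (w : seq nat) x :
  \max_(y <- rcons w x) y = maxn (\max_(y <- w) y) x.
Proof. by rewrite -cats1 big_cat big_seq1. Qed.

Lemma is_rgf1 : is_rgf [:: 1].
Proof. by split=> // -[]. Qed.

Lemma is_rgf_rcons w x : 0 < size w ->
  is_rgf (rcons w x) <-> is_rgf w /\ 0 < x <= 1 + \max_(y <- w) y.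
Proof.
move=> w0; split=> [[]|[[wpos w1 wS] /andP[x0 xle]]].
  rewrite all_rcons size_rcons nth_rcons w0 => /andP[x0 wpos] w1 wS.
  split; last first.
    rewrite x0; have := wS (size w); rewrite w0 leqnn nth_rcons ltnn eqxx.
    by rewrite -cats1 take_size_cat //; apply.
  split=> // [_|i /andP[i0 iw]]; first exact: w1.
  have := wS i; rewrite i0 ltnS (ltnW iw) nth_rcons iw -cats1.
  by rewrite (takel_cat _ (ltnW iw)); apply.
split; first by rewrite all_rcons x0.
  by rewrite nth_rcons w0 => _; apply: w1.
move=> i /andP[i0]; rewrite size_rcons ltnS leq_eqVlt => /predU1P[->|iw].
  by rewrite nth_rcons ltnn eqxx -cats1 take_size_cat.
by rewrite nth_rcons iw -cats1 (takel_cat _ (ltnW iw)) wS ?i0.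
Qed.

Lemma max_map_succ (w : seq nat) : 0 < size w ->
  \max_(y <- map succn w) y = (\max_(y <- w) y).+1.
Proof.
elim: w => // x [|y w] IH _; first by rewrite !big_seq1.
by rewrite map_cons big_cons IH // maxnSS [in RHS]big_cons.
Qed.

Lemma is_rgf_shift w : all (leq 1) w -> 0 < size w ->
  is_rgf (1 :: map succn w) <-> is_rgf w.
Proof.
move=> wpos w0.
have maxS i : 0 < i -> \max_(y <- 1 :: map succn (take i w)) y =
    (\max_(y <- take i w) y).+1.
  move=> i0; rewrite big_cons max_map_succ ?size_take_min ?leq_min ?i0 //.
  by rewrite maxnSS max0n.
split=> [[_ _ wS]|[_ w1 wS]].
  split=> // [_|i /andP[i0 iw]].
    (* The second letter of the shifted word is at most 1 + 1, so the first letter of [w] is at most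
       1. *)
    have := wS 1; rewrite /= size_map ltnS w0 take0 big_seq1 (nth_map 0) //.
    move=> /(_ isT) le2; apply/eqP; rewrite eqn_leq -ltnS le2.
    exact: (all_nthP 0 wpos).
  have := wS i.+1; rewrite /= size_map => /(_ iw).
  by rewrite (nth_map 0) // -map_take maxS.
split=> //=; first by rewrite all_map; apply/allP.
move=> [|[|i]] //; rewrite ltnS size_map /= => iw.
  by rewrite (nth_map 0) // w1 // take0 big_seq1.
by rewrite (nth_map 0) //= -map_take maxS // ltnS wS.
Qed.

(** Each appended letter exceeds the previous maximum by at most one, so no value below the maximum
    is skipped. *)
Lemma mem_rgf w x : is_rgf w -> (x \in w) = (0 < x <= \max_(y <- w) y).
Proof.
elim/last_ind: w x => [|w y IH] x rgfw; first by rewrite big_nil in_nil; case: x.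
have [/size0nil w0|w0] := posnP (size w).
  move: rgfw; rewrite w0 => -[_ /= -> // _].
  by rewrite mem_seq1 big_seq1; case: x => [|[]].
have [/IH{}IH /andP[y0 yle]] := (is_rgf_rcons _ w0).1 rgfw.
rewrite mem_rcons in_cons max_rcons leq_max IH.
have [->|] := eqVneq x y; first by rewrite y0 leqnn orbT.
move=> neqxy; case: ltnP => //= x0.
case: leqP => //= xgt; apply/esym/negbTE.
by rewrite -ltnNge ltn_neqAle eq_sym neqxy (leq_trans yle).
Qed.

(** By [mem_rgf] the values above [x] fill a whole interval; hence the [lb] of an appended letter
    depends only on that letter and the maximum. *)
Lemma size_undup_gt w x : is_rgf w ->
  size (undup [seq y <- w | x < y]) = \max_(y <- w) y - x.
Proof.
move=> rgfw; rewrite -[RHS](size_iota x.+1).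
apply/perm_size/uniq_perm; rewrite ?undup_uniq ?iota_uniq // => y.
rewrite mem_undup mem_filter mem_rgf // mem_iota.
case: ltnP => //= xy; rewrite (leq_trans _ xy) //=.
set m := \max_(y <- w) y; case: (leqP x m) => xm.
  by rewrite addSn subnKC // ltnS.
(* Here [m < x]: truncated subtraction gives 0 and the interval is empty. *)
rewrite (eqP (ltnW xm)) addn0 ltnS [RHS]leqNgt xy.
by apply/negbTE; rewrite -ltnNge (ltn_trans xm).
Qed.

(** * Effect of appending, prepending and shifting on lb and rs *)

Lemma lb_rcons w x :
  lb (rcons w x) = lb w + size (undup [seq y <- w | x < y]).
Proof.
rewrite /lb size_rcons big_ord_recr /=; congr (_ + _).
  apply: eq_bigr => j _; rewrite /lb_at nth_rcons ltn_ord -cats1.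
  by rewrite takel_cat // ltnW.
by rewrite /lb_at nth_rcons ltnn eqxx -cats1 take_size_cat.
Qed.

Lemma rs_cons w x : rs (x :: w) = size (undup [seq y <- w | y < x]) + rs w.
Proof. by rewrite /rs big_ord_recl /rs_at /= drop0. Qed.

(** The prepended 1 is larger than no letter to its right, and raising the other letters keeps their
    comparisons. *)
Lemma lb_shift w : lb (1 :: map succn w) = lb w.
Proof.
elim/last_ind: w => [|w x IH].
  by rewrite /lb big_ord_recl !big_ord0.
rewrite map_rcons -rcons_cons !lb_rcons IH /= filter_map undup_map_inj.
  by rewrite size_map.
exact: succn_inj.
Qed.

Lemma rs_map_succ w : rs (map succn w) = rs w.
Proof.
elim: w => //= x w IH; rewrite !rs_cons IH filter_map undup_map_inj.
  by rewrite size_map.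
exact: succn_inj.
Qed.

Lemma rs_cons1 w : all (leq 1) w -> rs (1 :: w) = rs w.
Proof.
move=> wpos; rewrite rs_cons [filter _ _](_ : _ = [::]) //.
apply/eqP; rewrite -[_ == _]negbK -has_filter -all_predC.
by apply: sub_all wpos => y; rewrite /= -ltnNge.
Qed.

Lemma rs_shift w : rs (1 :: map succn w) = rs w.
Proof. by rewrite rs_cons1 ?rs_map_succ // all_map; apply/allP. Qed.

Lemma size_undup_rcons (w : seq nat) x :
  size (undup (rcons w x)) = (x \notin w) + size (undup w).
Proof.
have /perm_undup/perm_size -> : rcons w x =i x :: w by move=> y; rewrite mem_rcons.
by rewrite /=; case: (x \in w).
Qed.

(** Only distinct values count, and the second [x] is not a new value to the right of any letter of
    [w]. *)
Lemma rs_rcons2 w x : rs (rcons (rcons w x) x) = rs (rcons w x).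
Proof.
elim: w => [|y w IH]; first by rewrite /= !rs_cons /= ltnn.
rewrite !rcons_cons !rs_cons IH; congr (_ + _).
rewrite !filter_rcons; case: ltnP => // _.
by rewrite size_undup_rcons mem_rcons mem_head.
Qed.

(** The appended [x] is a new smaller value to the right of every letter of [w], and nothing stands
    to its own right. *)
Lemma rs_rcons_min w x : all (ltn x) w -> rs (rcons w x) = rs w + size w.
Proof.
elim: w => [|y w IH] /= => [_|/andP[xy xw]]; first by rewrite rs_cons addn0.
rewrite !rs_cons IH // filter_rcons xy size_undup_rcons mem_filter xy /=.
rewrite (negbTE (_ : x \notin w)) ?add1n ?addSn ?addnS ?addnA //.
by apply/negP => /(allP xw); rewrite /= ltnn.
Qed.

(** * Standardization and avoidance of 112 and 122 *)

Lemma index_sort_leq (u : seq nat) : {in u &, forall x y,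
  (index x (sort leq (undup u)) <= index y (sort leq (undup u))) = (x <= y)}.
Proof.
move=> x y xu yu; set s := sort _ _.
have mem_s z : z \in u -> z \in s by rewrite mem_sort mem_undup.
have idx_leq a b : a \in u -> b \in u -> index a s <= index b s -> a <= b.
  move=> au bu; apply: (sorted_leq_index leq_trans leqnn); rewrite ?mem_s //.
  exact: sort_sorted leq_total _.
apply/idP/idP => [|xy]; first exact: idx_leq.
rewrite leqNgt; apply/negP => /[dup] /ltnW /idx_leq yx.
have -> : x = y by apply/eqP; rewrite eqn_leq xy yx.
by rewrite ltnn.
Qed.

(** Lets the order relations among the letters of [u] be read off from a known standardization. *)
Lemma leq_standardize u i j : i < size u -> j < size u ->
  (nth 0 (standardize u) i <= nth 0 (standardize u) j) = (nth 0 u i <= nth 0 u j).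
Proof.
by move=> iu ju; rewrite !(nth_map 0) // ltnS index_sort_leq ?mem_nth.
Qed.

Lemma size_standardize u : size (standardize u) = size u.
Proof. exact: size_map. Qed.

Lemma standardize_112 u :
  standardize u = [:: 1; 1; 2] <-> exists a b, a < b /\ u = [:: a; a; b].
Proof.
split=> [std|[a [b [ab ->]]]].
  have := size_standardize u; rewrite std.
  case: u std => [|a [|b [|c []]]] // std _.
  have leE := @leq_standardize [:: a; b; c].
  exists b, c; have := (leE 0 1 isT isT, leE 1 0 isT isT, leE 2 1 isT isT).
  rewrite std /= => -[[ab ba] cb]; split; first by rewrite ltnNge -cb.
  by congr (_ :: _); apply/eqP; rewrite eqn_leq -ab -ba.
rewrite /standardize /= !inE eqxx (ltn_eqF ab) (sorted_sort leq_trans) /=.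
  by rewrite eqxx (ltn_eqF ab) eqxx.
by rewrite ltnW.
Qed.

Lemma standardize_122 u :
  standardize u = [:: 1; 2; 2] <-> exists a b, a < b /\ u = [:: a; b; b].
Proof.
split=> [std|[a [b [ab ->]]]].
  have := size_standardize u; rewrite std.
  case: u std => [|a [|b [|c []]]] // std _.
  have leE := @leq_standardize [:: a; b; c].
  exists a, b; have := (leE 1 0 isT isT, leE 1 2 isT isT, leE 2 1 isT isT).
  rewrite std /= => -[[ba bc] cb]; split; first by rewrite ltnNge -ba.
  by congr [:: _, _ & _]; congr (_ :: _); apply/eqP; rewrite eqn_leq -bc -cb.
rewrite /standardize /= !inE eqxx (ltn_eqF ab) (sorted_sort leq_trans) /=.
  by rewrite eqxx (ltn_eqF ab) eqxx.
by rewrite ltnW.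
Qed.

Lemma avoids_112 w :
  avoids w [:: 1; 1; 2] <-> forall a b, a < b -> ~~ subseq [:: a; a; b] w.
Proof.
split=> [av a b ab|av [u aab /standardize_112[a [b [ab uE]]]]].
  by apply/negP => aab; apply: av; exists [:: a; a; b] => //;
    apply/standardize_112; exists a, b.
by move: aab; rewrite uE; apply/negP/av.
Qed.

Lemma avoids_122 w :
  avoids w [:: 1; 2; 2] <-> forall a b, a < b -> ~~ subseq [:: a; b; b] w.
Proof.
split=> [av a b ab|av [u abb /standardize_122[a [b [ab uE]]]]].
  by apply/negP => abb; apply: av; exists [:: a; b; b] => //;
    apply/standardize_122; exists a, b.
by move: abb; rewrite uE; apply/negP/av.
Qed.

Lemma subseq_rcons_rcons (T : eqType) (s w : seq T) a x :
  subseq (rcons s a) (rcons w x) =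
    if a == x then subseq s w else subseq (rcons s a) w.
Proof.
rewrite -subseq_rev !rev_rcons /=.
by case: ifP; rewrite -?rev_rcons subseq_rev.
Qed.

Lemma avoids_subseq w w' v : subseq w' w -> avoids w v -> avoids w' v.
Proof.
move=> w'w av [u uw' uv]; apply: av; exists u => //.
exact: subseq_trans w'w.
Qed.

(** A final 1 could only act as the 2 of the pattern, and [w] has no letter below 1. *)
Lemma avoids_112_rcons1 w :
  all (leq 1) w -> avoids w [:: 1; 1; 2] -> avoids (rcons w 1) [:: 1; 1; 2].
Proof.
move=> wpos /avoids_112 av; apply/avoids_112 => a b ab.
rewrite (subseq_rcons_rcons [:: a; a]); case: eqP => [b1|_]; last exact: av.
apply/negP => /mem_subseq/(_ a); rewrite mem_head => /(_ isT)/(allP wpos).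
by rewrite leqNgt -b1 ab.
Qed.

(** The leading 1 could only act as the first of two equal letters, and no raised letter equals
    1. *)
Lemma avoids_112_shift w : all (leq 1) w ->
  avoids (1 :: map succn w) [:: 1; 1; 2] <-> avoids w [:: 1; 1; 2].
Proof.
move=> wpos; split=> /avoids_112 av; apply/avoids_112 => a b ab.
  apply/negP => /(map_subseq succn) /= aab; have /negP := av a.+1 b.+1 ab.
  by apply; apply: subseq_trans aab (subseq_cons _ _).
rewrite [subseq _ _]/=; case: eqP => [->|_].
  apply/negP => /mem_subseq/(_ 1); rewrite mem_head => /(_ isT)/mapP[y yw [y0]].
  by have := allP wpos y yw; rewrite -y0.
apply/negP => aab.
(* An occurrence among the raised letters is lowered back to [w]; [predn] preserves [a < b] because
   [a] is positive. *)
have /(map_subseq predn) := aab.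
rewrite (mapK succnK) /=; apply/negP/av.
have /allP/= pos : all (leq 1) (map succn w) by rewrite all_map; apply/allP.
have a0 : 0 < a by apply/pos/(mem_subseq aab)/mem_head.
by rewrite ltn_predRL prednK.
Qed.

Lemma avoids_122_rcons1 w :
  all (leq 1) w -> avoids w [:: 1; 2; 2] -> avoids (rcons w 1) [:: 1; 2; 2].
Proof.
move=> wpos /avoids_122 av; apply/avoids_122 => a b ab.
rewrite (subseq_rcons_rcons [:: a; b]); case: eqP => [b1|_]; last exact: av.
apply/negP => /mem_subseq/(_ a); rewrite mem_head => /(_ isT)/(allP wpos).
by rewrite leqNgt -b1 ab.
Qed.

(** As last letter, [x] could only act as the second of the two equal letters, whose first would
    then lie in [w]. *)
Lemma avoids_122_rcons_new w x : x \notin w ->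
  avoids w [:: 1; 2; 2] -> avoids (rcons w x) [:: 1; 2; 2].
Proof.
move=> xw /avoids_122 av; apply/avoids_122 => a b ab.
rewrite (subseq_rcons_rcons [:: a; b]); case: eqP => [bx|_]; last exact: av.
apply: contra xw => /mem_subseq/(_ b); rewrite -bx; apply.
by rewrite !inE eqxx orbT.
Qed.

(** * The two growth steps *)

Definition rgf_av w v := [/\ 0 < size w, is_rgf w & avoids w v].

(* The two ways of building a word from a shorter one are appending 1 and
   applying T; [grows_inv] and [grows_disj] say that exactly one applies. *)
Record grows (v : seq nat) (T : seq nat -> seq nat) : Prop := Grows {
  grows1 : avoids [:: 1] v;
  grows_rcons1 : forall w, rgf_av w v -> avoids (rcons w 1) v;
  growsT : forall w, rgf_av w v -> rgf_av (T w) v;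
  grows_inv : forall w x, 0 < size w -> rgf_av (rcons w x) v ->
    x = 1 \/ exists2 w', rgf_av w' v & rcons w x = T w';
  grows_disj : forall w w', rgf_av w v -> T w <> rcons w' 1;
  grows_inj : injective T;
  grows_size : forall w, size (T w) = (size w).+1;
  grows_max : forall w, 0 < size w -> \max_(y <- T w) y = (\max_(y <- w) y).+1;
  grows_lb : forall w, lb (T w) = lb w
}.

Lemma rgf_pos w : is_rgf w -> all (leq 1) w.
Proof. by case. Qed.

Lemma rgf_max_gt0 w : 0 < size w -> is_rgf w -> 0 < \max_(y <- w) y.
Proof.
by case: w => // x w _ /rgf_pos /= /andP[x0 _]; rewrite big_cons leq_max x0.
Qed.

Definition shift112 w := 1 :: map succn w.
Definition new_max w := rcons w (\max_(y <- w) y).+1.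

(** If the last letter [x] is not 1, a second 1 would give an occurrence 1 1 x; so all letters after
    the leading 1 are at least 2 and can be lowered. *)
Lemma grows_112 : grows [:: 1; 1; 2] shift112.
Proof.
split=> [|w [_ rgfw av]|w [w0 rgfw av]|w x w0 [_ rgfw av]|w w' [w0 rgfw _]|||w w0|].
- apply/avoids_112 => a b _; apply/negP => /size_subseq; by [].
- exact: avoids_112_rcons1 (rgf_pos rgfw) av.
- have wpos := rgf_pos rgfw.
  by split=> //; [apply/is_rgf_shift|apply/avoids_112_shift].
- have [->|x1] := eqVneq x 1; [by left|right].
  case: w w0 rgfw av => // y w _ rgfw av.
  have y1 : y = 1 by case: rgfw => _ /(_ isT).
  have tgt : all (leq 2) (rcons w x).
    have pos z : z \in rcons w x -> 0 < z.
      by move=> zt; apply: (allP (rgf_pos rgfw)); rewrite rcons_cons in_cons zt orbT.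
    apply/allP => z zt; rewrite ltn_neqAle pos // andbT.
    apply/eqP => z1; have := (avoids_112 _).1 av 1 x.
    rewrite ltn_neqAle eq_sym x1 pos ?mem_rcons ?mem_head // => /(_ isT).
    rewrite rcons_cons y1 /= (subseq_rcons_rcons [:: 1]) eqxx sub1seq.
    by move: zt; rewrite -z1 mem_rcons in_cons eq_sym (negbTE x1) /= => ->.
  have tE : map succn (map predn (rcons w x)) = rcons w x.
    rewrite -map_comp -[RHS]map_id; apply/eq_in_map => z /(allP tgt).
    by case: z.
  have wE : rcons (y :: w) x = shift112 (map predn (rcons w x)).
    by rewrite /shift112 tE y1.
  have pos' : all (leq 1) (map predn (rcons w x)).
    by rewrite all_map; apply: sub_all tgt => -[].
  have size' : 0 < size (map predn (rcons w x)) by rewrite size_map size_rcons.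
  exists (map predn (rcons w x)) => //; rewrite wE in rgfw av.
  by split=> //; [apply/is_rgf_shift|apply/avoids_112_shift].
- case/lastP: w w0 rgfw => // w z _ /rgf_pos; rewrite all_rcons => /andP[z0 _].
  rewrite /shift112 map_rcons -rcons_cons => /rcons_inj[_ z1].
  by rewrite z1 in z0.
- by move=> w w' [] /(inj_map succn_inj).
- by move=> w; rewrite /= size_map.
- by rewrite big_cons max_map_succ // maxnSS max0n.
- exact: lb_shift.
Qed.

(** If the last letter [x] is not 1, an earlier [x] would give an occurrence 1 x x; so [x] is new,
    and by [mem_rgf] it is the maximum plus 1. *)
Lemma grows_122 : grows [:: 1; 2; 2] new_max.
Proof.
split=> [|w [_ rgfw av]|w [w0 rgfw av]|w x w0 [_ rgfw av]|w w' [w0 rgfw _]|||w w0|].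
- by apply/avoids_122 => a b _; apply/negP => /size_subseq.
- exact: avoids_122_rcons1 (rgf_pos rgfw) av.
- split; first by rewrite size_rcons.
    by apply/is_rgf_rcons => //; split; rewrite //= add1n.
  by apply: avoids_122_rcons_new av; rewrite mem_rgf // ltnn andbF.
- have [->|x1] := eqVneq x 1; [by left|right].
  have [rgfw' /andP[x0 xle]] := (is_rgf_rcons _ w0).1 rgfw.
  have av' := avoids_subseq (subseq_rcons w x) av.
  exists w => //; congr rcons; apply/eqP; rewrite eqn_leq xle leqNgt /= ltnS.
  apply/negP => xm; have xw : x \in w by rewrite mem_rgf // x0.
  case: w w0 {rgfw rgfw' av' xle xm} (rgfw') av xw => // y w _ [_ /(_ isT)/= -> _].
  rewrite in_cons (negbTE x1) /= => /avoids_122 /(_ 1 x) av xw.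
  have xgt : 1 < x by rewrite ltn_neqAle eq_sym x1.
  have := av xgt; rewrite /= (subseq_rcons_rcons [:: x]) eqxx.
  by rewrite sub1seq xw.
- move=> /rcons_inj[_] m0; have := rgf_max_gt0 w0 rgfw; rewrite m0 //.
- by move=> w w' /rcons_inj[].
- by move=> w; rewrite size_rcons.
- by rewrite max_rcons; apply/maxn_idPr.
- move=> w; rewrite lb_rcons [filter _ _](_ : _ = [::]) ?addn0 //.
  apply/eqP; rewrite -[_ == _]negbK -has_filter -all_predC; apply/allP => y yw.
  by rewrite /= -leqNgt; apply: leqW; apply: leq_bigmax_seq.
Qed.

(** * Coding of the avoiders by bit sequences *)

Fixpoint bitseqs n : seq bitseq :=
  if n is n'.+1 then map (cons true) (bitseqs n') ++ map (cons false) (bitseqs n')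
  else [:: [::]].

(** The head bit is the step applied last, so the construction follows the code from right to left,
    starting from the word 1. *)
Fixpoint decode (T : seq nat -> seq nat) (b : bitseq) : seq nat :=
  match b with
  | [::] => [:: 1]
  | true :: b' => T (decode T b')
  | false :: b' => rcons (decode T b') 1
  end.

Lemma mem_bitseqs n b : (b \in bitseqs n) = (size b == n).
Proof.
elim: n b => [|n IH] [|x b] //=.
  by apply/negbTE/negP; rewrite mem_cat => /orP[] /mapP[].
rewrite mem_cat eqSS -IH; case: x.
  rewrite mem_map; last by move=> ? ? [].
  by rewrite orbC; case: mapP => // -[].
rewrite (mem_map (f := cons false)); last by move=> ? ? [].
by case: mapP => // -[].
Qed.

Lemma bitseqs_uniq n : uniq (bitseqs n).
Proof.
elim: n => //= n IH; rewrite cat_uniq !map_inj_uniq ?IH; try by move=> ? ? [].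
by rewrite andbT; apply/hasPn => _ /mapP[b _ ->]; apply/mapP => -[].
Qed.

Section Decode.
Variables (v : seq nat) (T : seq nat -> seq nat).
Hypothesis vT : grows v T.

Lemma size_decode b : size (decode T b) = (size b).+1.
Proof. by elim: b => //= -[] b <-; rewrite ?(grows_size vT) ?size_rcons. Qed.

Lemma size_decode_gt0 b : 0 < size (decode T b).
Proof. by rewrite size_decode. Qed.

Lemma rgf_av_rcons1 w : rgf_av w v -> rgf_av (rcons w 1) v.
Proof.
move=> wv; have [w0 rgfw _] := wv.
split; [by rewrite size_rcons| |exact: (grows_rcons1 vT)].
by apply/is_rgf_rcons => //; split; rewrite //= add1n.
Qed.

Lemma rgf_av_decode b : rgf_av (decode T b) v.
Proof.
elim: b => [|[] b IH] /=.
- by split=> //; [exact: is_rgf1|exact: grows1 vT].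
- exact: (growsT vT).
- exact: rgf_av_rcons1.
Qed.

Lemma is_rgf_decode b : is_rgf (decode T b).
Proof. by have [] := rgf_av_decode b. Qed.

(** Every step adds one letter, so the codes have equal length; [grows_disj] then forces equal head
    bits, and the step can be undone. *)
Lemma decode_inj : injective (decode T).
Proof.
have size_eq b c : decode T b = decode T c -> size b = size c.
  by move/(congr1 size); rewrite !size_decode => -[].
elim=> [|x b IH] [|y c] E; have := size_eq _ _ E => //= _.
case: x y E => -[] /=.
- by move/(grows_inj vT)/IH ->.
- by move/(grows_disj vT) => /(_ (rgf_av_decode _)).
- by move/esym/(grows_disj vT) => /(_ (rgf_av_decode _)).
- by case/rcons_inj => /IH ->.
Qed.

Lemma decode_surj w : rgf_av w v -> exists b, w = decode T b.
Proof.
(* Induction on a bound for the length, since the preimage of a word under [T] need not be a prefix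
   of it. *)
move: {2}(size w) (leqnn (size w)) => n.
elim: n w => [|n IH] w szw wv; first by case: wv; case: w szw.
case/lastP: w wv szw => [[]//|w x] wv; rewrite size_rcons ltnS => szw.
have [/size0nil w0|w0] := posnP (size w).
  exists [::]; rewrite w0 in wv *.
  by case: wv => _ [_ /= ->].
have [x1|[w' w'v E]] := grows_inv vT w0 wv.
  have [||b E] := IH w => //.
    case: wv => _ /(is_rgf_rcons _ w0)[rgfw _] av; split=> //.
    exact: avoids_subseq (subseq_rcons _ _) av.
  by exists (false :: b); rewrite x1 /= -E.
have [||b Eb] := IH w' => //; last by exists (true :: b); rewrite E /= -Eb.
by have := congr1 size E; rewrite size_rcons (grows_size vT) => -[<-].
Qed.

Lemma max_decode b : \max_(y <- decode T b) y = (count_mem true b).+1.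
Proof.
elim: b => [|[] b IH] /=; first by rewrite big_seq1.
  by rewrite (grows_max vT) ?size_decode_gt0 // IH add1n.
by rewrite max_rcons IH add0n; apply/maxn_idPl.
Qed.

Lemma lb_decode_true b : lb (decode T (true :: b)) = lb (decode T b).
Proof. exact: grows_lb vT _. Qed.

(** The values larger than the appended 1 are those from 2 to the maximum, one for each [true]
    bit. *)
Lemma lb_decode_false b :
  lb (decode T (false :: b)) = lb (decode T b) + count_mem true b.
Proof.
by rewrite /= lb_rcons (size_undup_gt _ (is_rgf_decode b)) max_decode subn1.
Qed.

Lemma RGF_av_decode n :
  RGF_av n.+1 v = [set` map (decode T) (bitseqs n)]%classic.
Proof.
apply/seteqP; split=> w /=.
  move=> [[szw rgfw] av].
  have [|b wE] := @decode_surj w; first by rewrite /rgf_av szw.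
  rewrite wE map_f // mem_bitseqs -eqSS -size_decode -wE; exact/eqP.
case/mapP => b; rewrite mem_bitseqs => /eqP szb ->.
have [_ rgfb avb] := rgf_av_decode b.
by split=> //; split=> //; rewrite size_decode szb.
Qed.

Local Open Scope ring_scope.

Lemma fsum_RGF_av n (s : seq nat -> nat) :
  \sum_(w \in RGF_av n.+1 v) ('X^(s w) : {poly int}) =
  \sum_(b <- bitseqs n) 'X^(s (decode T b)).
Proof.
rewrite RGF_av_decode -fsbig_seq ?big_map //.
by rewrite map_inj_uniq ?bitseqs_uniq //; exact: decode_inj.
Qed.

End Decode.

(** * The recursion for rs on 112-avoiders *)

Lemma rs_decode_true b :
  rs (decode shift112 (true :: b)) = rs (decode shift112 b).
Proof. exact: rs_shift. Qed.

Lemma rs_decode_false2 b :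
  rs (decode shift112 (false :: false :: b)) = rs (decode shift112 (false :: b)).
Proof. exact: rs_rcons2. Qed.

(** After a [true] step only the leading letter is 1, so the appended 1 is below all [size b] + 1
    raised letters. In the reversed code, with [true] as 1 and [false] as 0, this is a descent at
    position [size b] + 1. *)
Lemma rs_decode_false_true b :
  rs (decode shift112 (false :: true :: b)) = rs (decode shift112 b) + (size b).+1.
Proof.
have wpos := rgf_pos (is_rgf_decode grows_112 b).
rewrite /= rs_cons1 ?rs_rcons_min ?rs_map_succ.
- by rewrite size_map (size_decode grows_112).
- by rewrite all_map.
by rewrite all_rcons all_map; apply/allP.
Qed.

Local Open Scope ring_scope.

(** * q-binomial coefficients and the two q-Pascal rules *)

Lemma qbinom_small n k : (n < k)%N -> qbinom n k = 0.
Proof. by move=> nk; rewrite /qbinom leqNgt nk. Qed.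

Lemma qfact_neq0 n : qfact n != 0.
Proof. exact/monic_neq0/qfact_monic. Qed.

Lemma qfact0 : qfact 0 = 1.
Proof. by rewrite /qfact big_geq. Qed.

(** Nonzero q-factorials can be cancelled, so [qbinomM] characterizes [qbinom] and polynomial
    division need not be handled again. *)
Lemma qbinom_eq n k p : (k <= n)%N ->
  p * (qfact k * qfact (n - k)) = qfact n -> qbinom n k = p.
Proof.
move=> kn; rewrite -(qbinomM kn) => /mulIf -> //.
by rewrite mulf_neq0 ?qfact_neq0.
Qed.

Lemma qbinom0 n : qbinom n 0 = 1.
Proof. by apply: qbinom_eq; rewrite // subn0 qfact0 !mul1r. Qed.

Lemma qbinomnn n : qbinom n n = 1.
Proof. by apply: qbinom_eq; rewrite // subnn qfact0 mulr1 mul1r. Qed.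

Lemma qbinom_sub n k : (k <= n)%N -> qbinom n (n - k) = qbinom n k.
Proof.
move=> kn; apply: qbinom_eq; first exact: leq_subr.
by rewrite subKn // [qfact (n - k) * _]mulrC qbinomM.
Qed.

(** With denominators cleared, this is [qint n.+1 = qint k.+1 + 'X^(k.+1) * qint (n - k)]. *)
Lemma qbinomS n k :
  qbinom n.+1 k.+1 = qbinom n k + 'X^(k.+1) * qbinom n k.+1.
Proof.
have [nk|kn|->] := ltngtP n k.
- by rewrite !qbinom_small ?mulr0 ?addr0 // ltnW.
- apply: qbinom_eq; first exact: ltnW.
  rewrite subSS mulrDl [qfact k.+1 in X in X + _]qfactS.
  have -> : qbinom n k * (qfact k * qint k.+1 * qfact (n - k)) =
      qfact n * qint k.+1 by rewrite -(qbinomM (ltnW kn)); ring.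
  have -> : 'X^(k.+1) * qbinom n k.+1 * (qfact k.+1 * qfact (n - k)) =
      qfact n * ('X^(k.+1) * qint (n - k)).
    rewrite -(qbinomM kn) -[in LHS](subnSK kn).
    by rewrite (qfactS (n - k.+1)) subnSK //; ring.
  by rewrite -mulrDr -qintD qfactS addSn subnKC // ltnW.
by rewrite !qbinomnn qbinom_small // mulr0 addr0.
Qed.

(** This is [qbinomS] at [n - k.+1], transported by the symmetry [qbinom_sub]. *)
Lemma qbinomS_dual n k : (k <= n)%N ->
  qbinom n.+1 k.+1 = 'X^(n - k) * qbinom n k + qbinom n k.+1.
Proof.
rewrite leq_eqVlt => /predU1P[->|kn].
  by rewrite !qbinomnn subnn qbinom_small // mulr1 addr0.
rewrite -[LHS]qbinom_sub ?subSS; last exact: ltnW.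
rewrite -(subnSK kn) qbinomS (subnSK kn) (qbinom_sub kn) addrC.
by rewrite (qbinom_sub (ltnW kn)).
Qed.

(** * Inversions and major index over bit sequences *)

Lemma sum_bitseqsS n t (F : bitseq -> {poly int}) :
  \sum_(b <- bitseqs n.+1 | count_mem true b == t.+1) F b =
  \sum_(b <- bitseqs n | count_mem true b == t) F (true :: b) +
  \sum_(b <- bitseqs n | count_mem true b == t.+1) F (false :: b).
Proof. by rewrite big_cat !big_map. Qed.

Lemma sum_bitseqs0 n (F : bitseq -> {poly int}) :
  \sum_(b <- bitseqs n.+1 | count_mem true b == 0%N) F b =
  \sum_(b <- bitseqs n | count_mem true b == 0%N) F (false :: b).
Proof. by rewrite big_cat !big_map /= big_pred0 ?add0r. Qed.

(** The hypotheses make [s] count the pairs with a [false] before a [true]; splitting by the head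
    bit reproduces [qbinomS]. *)
Lemma sum_inversions (s : bitseq -> nat) :
    s [::] = 0%N -> (forall b, s (true :: b) = s b) ->
    (forall b, s (false :: b) = (s b + count_mem true b)%N) ->
  forall n t, \sum_(b <- bitseqs n | count_mem true b == t) 'X^(s b) = qbinom n t.
Proof.
move=> s0 sT sF.
have sumF n t : \sum_(b <- bitseqs n | count_mem true b == t) 'X^(s (false :: b)) =
    'X^t * \sum_(b <- bitseqs n | count_mem true b == t) 'X^(s b) :> {poly int}.
  by rewrite mulr_sumr; apply: eq_bigr => b /eqP <-; rewrite sF exprD mulrC.
elim=> [|n IH] [|t].
- by rewrite big_cons big_nil s0 qbinom0 addr0.
- by rewrite big_cons big_nil qbinom_small.
- by rewrite sum_bitseqs0 sumF IH !qbinom0 mul1r.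
rewrite sum_bitseqsS sumF !IH qbinomS.
by under eq_bigr do rewrite sT; rewrite IH.
Qed.

(* Prepending [false] to a sequence starting with [true] creates a descent;
   hence the induction also tracks the sequences starting with [false]. *)
Lemma sum_descents (s : bitseq -> nat) :
    s [::] = 0%N -> s [:: false] = 0%N -> (forall b, s (true :: b) = s b) ->
    (forall b, s (false :: false :: b) = s (false :: b)) ->
    (forall b, s (false :: true :: b) = (s b + (size b).+1)%N) ->
  forall n t,
    \sum_(b <- bitseqs n | count_mem true b == t) 'X^(s b) = qbinom n t /\
    \sum_(b <- bitseqs n | count_mem true b == t) 'X^(s (false :: b)) =
      'X^t * qbinom n t.
Proof.
move=> s0 sF0 sT sFF sFT; elim=> [|n IH] t.
  rewrite !big_cons !big_nil s0 sF0; case: t => [|t] /=.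
    by rewrite qbinom0 addr0 mul1r.
  by rewrite qbinom_small // mulr0.
split; case: t => [|t].
- by rewrite sum_bitseqs0 (IH 0%N).2 !qbinom0 mul1r.
- rewrite sum_bitseqsS (IH t.+1).2 qbinomS; congr (_ + _).
  by under eq_bigr do rewrite sT; rewrite (IH t).1.
- rewrite sum_bitseqs0; under eq_bigr do rewrite sFF.
  by rewrite (IH 0%N).2 !qbinom0.
rewrite sum_bitseqsS.
under [in X in _ + X]eq_bigr do rewrite sFF.
rewrite (IH t.+1).2.
(* The new descent adds [size b] + 1, which is the constant [n.+1] on [bitseqs n]. *)
have -> : \sum_(b <- bitseqs n | count_mem true b == t) 'X^(s (false :: true :: b)) =
    'X^(n.+1) * qbinom n t :> {poly int}.
  rewrite -(IH t).1 mulr_sumr big_seq_cond [RHS]big_seq_cond.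
  apply: eq_bigr => b /andP[].
  by rewrite mem_bitseqs => /eqP <- _; rewrite sFT exprD mulrC.
(* For [t <= n] the powers combine as [t.+1 + (n - t) = n.+1], which turns the dual rule into the
   goal; for [t > n] all terms vanish. *)
have [tn|nt] := leqP t n; last by rewrite !qbinom_small ?mulr0 ?addr0 // ltnW.
by rewrite qbinomS_dual // mulrDr mulrA -exprD addSn subnKC.
Qed.

Lemma sum_bitseqs_count n (F : bitseq -> {poly int}) :
  \sum_(b <- bitseqs n) F b =
  \sum_(t < n.+1) \sum_(b <- bitseqs n | count_mem true b == t) F b.
Proof.
rewrite (exchange_big_dep xpredT) //= big_seq [RHS]big_seq; apply: eq_bigr => b.
rewrite mem_bitseqs => /eqP szb.
have bt : (count_mem true b < n.+1)%N by rewrite ltnS -szb count_size.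
by rewrite (big_pred1 (Ordinal bt)).
Qed.

(** * Generating functions of the avoiders *)

Lemma fsum_qbinom n :
  \sum_(t \in [set: nat]%classic) qbinom n t = \sum_(t < n.+1) qbinom n t.
Proof.
rewrite -(big_mkord xpredT (qbinom n)) (fsbigE (index_iota 0 n.+1)) ?iota_uniq //.
- by apply: eq_bigl => t; rewrite in_setT.
(* [qbinom n t] vanishes for [t > n], so the sum over all naturals has finite support and is not a
   default 0. *)
- move=> t _ /=; rewrite mem_index_iota -leqNgt; exact: qbinom_small.
Qed.

(** Serves both patterns at once: for any [grows] pair, [lb] satisfies the inversion recursion on
    codes. *)
Lemma LB_qbinom v T n : grows v T ->
  LB n.+1 v = \sum_(t < n.+1) qbinom n t.
Proof.
move=> vT; rewrite /LB (fsum_RGF_av vT) sum_bitseqs_count.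
apply: eq_bigr => t _; apply: (@sum_inversions (lb \o decode T)) => [|b|b] /=.
- by rewrite /lb big_ord1.
- exact: lb_decode_true vT b.
- exact: lb_decode_false vT b.
Qed.

Lemma RS_112_qbinom n :
  RS n.+1 [:: 1; 1; 2]%N = \sum_(t < n.+1) qbinom n t.
Proof.
rewrite /RS (fsum_RGF_av grows_112) sum_bitseqs_count.
apply: eq_bigr => t _.
apply: (proj1 (@sum_descents (rs \o decode shift112) _ _ _ _ _ n t)) => [||b|b|b] /=.
- by rewrite /rs big_ord1.
- by rewrite /rs !big_ord_recl big_ord0.
- exact: rs_decode_true.
- exact: rs_decode_false2.
- exact: rs_decode_false_true.
Qed.

Theorem theorem2p1 (n : nat) (hn : (1 <= n)%N) :
  [/\ LB n [:: 1; 1; 2]%N = RS n [:: 1; 1; 2]%N,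
      RS n [:: 1; 1; 2]%N = LB n [:: 1; 2; 2]%N
    & LB n [:: 1; 2; 2]%N =
        \sum_(t \in [set: nat]%classic) qbinom (n - 1) t].
Proof.
case: n hn => // n _; rewrite subn1 fsum_qbinom RS_112_qbinom.
by rewrite (LB_qbinom _ grows_112) (LB_qbinom _ grows_122).
Qed.
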